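(* Consider a finite hidden Markov model with $N$ states, one-hot observations in $\mathcal Y=\{u_1,\dots,u_S\}$, initial distribution $\pi_0$, emission matrix $E\in\mathbb R^{S\times N}$ and deterministic transition matrix $T\in\mathbb R^{N\times N}$ (every column of $T$ is a canonical basis vector of $\mathbb R^N$). Let $r$ be the number of transient states, and let $T$ be represented (with the states suitably labelled) as $$T=\begin{bmatrix}T_{11}&0\\ T_{21}&P\end{bmatrix},$$ where $T_{11}\in\mathbb R^{r\times r}$ is strictly lower triangular with nilpotency index $\ell$ (with $\ell=1$ if $r=0$) and $P\in\mathbb R^{(N-r)\times(N-r)}$ is a permutation matrix. Set $$T'=\begin{bmatrix}I_r&0\\0&P\end{bmatrix}.$$ Then the optimal logits $\boldsymbol w_k^o$ can be reproduced (i.e. $\boldsymbol w_k=\boldsymbol w_k^o$ for $k\ge1$) by the dynamics $$\boldsymbol w_k=T'\boldsymbol w_{k-1}+\psi(k,\boldsymbol y_k,\dots,\boldsymbol y_{k-\ell+1}),$$ where $\psi$ is a nonlinear mapping that takes as input the most recent $\ell$ observations together with the time step $k$. The recursion is initialized at an arbitrary vector $w_0\in\mathbb R^N$, and the input to $\psi$ is padded with zeros for $k-\ell<0$.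
   Context: Hidden Markov model: states $x_1,\dots,x_N$, true state $\boldsymbol x_k^\star$ with $\boldsymbol x_0^\star\sim\pi_0$, $T=(t_{ij})$ column-stochastic with $t_{ij}=\mathbb P(\boldsymbol x^\star_{k+1}=x_i\mid \boldsymbol x_k^\star=x_j)$; observations $\boldsymbol y_k\in\{u_1,\dots,u_S\}$ (canonical basis vectors of $\mathbb R^S$), $k\ge1$, with $e_{ij}=\mathbb P(\boldsymbol y_k=u_i\mid\boldsymbol x_k^\star=x_j)$. Optimal logits: $\boldsymbol w^o_k=\log(T\exp(\boldsymbol w^o_{k-1}))+\log(E^\top\boldsymbol y_k)$ with $\boldsymbol w_0^o=\log\pi_0$, where $\log$ and $\exp$ act entrywise; equivalently $\boldsymbol w_k^o=\log\boldsymbol\beta_k$, where $\boldsymbol\beta_0=\pi_0$ and $\boldsymbol\beta_k=\operatorname{diag}\{E^\top\boldsymbol y_k\}\,T\,\boldsymbol\beta_{k-1}$ is the unnormalized Bayesian filter. The softmax of $\boldsymbol w_k^o$ is the belief vector $\mathbb P(\boldsymbol x_k^\star=\cdot\mid\boldsymbol y_{1:k})$. Transient states are states that, once exited, cannot be reentered; the others are recurrent. The first $r$ states in the block form are the transient ones, the last $N-r$ the recurrent ones. The nilpotency index of $T_{11}$ is the smallest $\ell\ge1$ with $T_{11}^\ell=0$. The mapping $\psi$ may depend on the model ($T,E,\pi_0$) and on the chosen $w_0$. Logits may have entries $-\infty=\log 0$, and the convention $-\infty\cdot0=0$ is used.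
   Formalization: Equality of the logits at time k is claimed only if, for all 1 ≤ j < k, every entry of T'w^o_j equal to −∞ is also −∞ in w^o_{j+1}; without this the claim is false, e.g. for 1→2→3→3 started at state 1 with uninformative observations. *)

(* Defs.v *)
From HB Require Import structures.
From mathcomp Require Import all_boot all_order all_algebra all_fingroup.
From mathcomp Require Import all_classical all_reals all_analysis.

Set Implicit Arguments.
Unset Strict Implicit.
Unset Printing Implicit Defensive.

Import Order.TTheory GRing.Theory Num.Theory.

Local Open Scope ring_scope.

Section HiddenMarkovModel.
Variable R : realType.

Definition prob_vector n (p : 'cV[R]_n) : Prop :=
  (forall i, 0 <= p i 0) /\ \sum_i p i 0 = 1.

Definition col_stochastic p n (A : 'M[R]_(p, n)) : Prop :=
  forall j, prob_vector (col j A).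

Definition deterministic n (T : 'M[R]_n) : Prop :=
  forall j, exists i, col j T = delta_mx i 0.

(* [T i j] is the probability of moving from [j] to [i]. *)
Definition transition n (T : 'M[R]_n) : rel 'I_n := fun j i => 0 < T i j.

(* A state that can be exited and that, once exited, cannot be reentered.  An
   absorbing state is never exited and is therefore not transient. *)
Definition transient n (T : 'M[R]_n) (j : 'I_n) : bool :=
  [exists i, (i != j) && transition T j i] &&
  [forall i, (i != j) && transition T j i ==> ~~ connect (transition T) i j].

Definition strictly_lower_triangular n (A : 'M[R]_n) : Prop :=
  forall i j : 'I_n, (i <= j)%N -> A i j = 0.

Definition nilpotency_index n (A : 'M[R]_n) (l : nat) : Prop :=
  [/\ (0 < l)%N, A ^+ l = 0 & forall d, (0 < d < l)%N -> A ^+ d != 0].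

End HiddenMarkovModel.

(* Logit vectors have entries in the extended reals; [0 * -oo = 0] there, so
   that zero entries of a matrix cancel infinite logits. *)
Section Logits.
Variable R : realType.
Local Open Scope ereal_scope.

Definition addv n (u v : 'cV[\bar R]_n) : 'cV[\bar R]_n :=
  map2_mx (fun a b => a + b) u v.

Definition mulmxv p n (A : 'M[R]_(p, n)) (v : 'cV[\bar R]_n) : 'cV[\bar R]_p :=
  \col_i \sum_j (A i j)%:E * v j ord0.

Definition logv n (v : 'cV[\bar R]_n) : 'cV[\bar R]_n := map_mx (@lne R) v.

Definition expv n (v : 'cV[\bar R]_n) : 'cV[\bar R]_n := map_mx (@expeR R) v.

Definition toev n (v : 'cV[R]_n) : 'cV[\bar R]_n := map_mx (@EFin R) v.

(* Observations are numbered from 1: in this section [y 0] is never used. *)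
Fixpoint optimal_logits n S (T : 'M[R]_n) (E : 'M[R]_(S, n)) (pi0 : 'cV[R]_n)
    (y : nat -> 'cV[R]_S) (k : nat) : 'cV[\bar R]_n :=
  if k is k'.+1 then
    addv (logv (mulmxv T (expv (optimal_logits T E pi0 y k'))))
         (logv (toev (E^T *m y k'.+1)%R))
  else logv (toev pi0).

(* y_k, ..., y_{k-l+1}, with zero vectors in place of y_0, y_{-1}, ... *)
Definition window S l (y : nat -> 'cV[R]_S) (k : nat) : 'I_l -> 'cV[R]_S :=
  fun d => if (d < k)%N then y (k - d)%N else 0%R.

Fixpoint linear_logits n S l (A : 'M[R]_n)
    (psi : nat -> ('I_l -> 'cV[R]_S) -> 'cV[\bar R]_n)
    (w0 : 'cV[R]_n) (y : nat -> 'cV[R]_S) (k : nat) : 'cV[\bar R]_n :=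
  if k is k'.+1 then
    addv (mulmxv A (linear_logits A psi w0 y k')) (psi k (window y k))
  else toev w0.

(* Necessary for [w' = A *m w + psi]: since -oo + a is never finite, an update
   cannot raise an entry of [A *m w] equal to -oo.  It can fail for consecutive
   optimal logits: a chain 1 -> 2 -> 3 -> 3 started at 1, with uninformative
   observations, has logits (-oo, 0, -oo) then (-oo, -oo, 0). *)
Definition additively_reachable n (A : 'M[R]_n) (w w' : 'cV[\bar R]_n) : Prop :=
  forall i, mulmxv A w i ord0 = -oo -> w' i ord0 = -oo.

End Logits.

(* Main.v *)
Require Import Defs.
From HB Require Import structures.
From mathcomp Require Import all_boot all_order all_algebra all_fingroup.
From mathcomp Require Import all_classical all_reals all_analysis.

Set Implicit Arguments.
Unset Strict Implicit.
Unset Printing Implicit Defensive.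

Import Order.TTheory GRing.Theory Num.Theory.

Local Open Scope ring_scope.

(** The optimal logits are [log beta_k] for the unnormalized filter
    [beta_k = diag (E^T y_k) T beta_(k-1)].  Since [T11 ^+ l = 0], the transient
    entries of [beta_k] vanish for [k >= l].  Hence for [k > l] the mapping [psi]
    only has to add [log (E^T y_k)] to the recurrent entries, which [P] permutes
    exactly as [T] does, and [-oo] to the transient ones.  For [k <= l] the
    window contains the whole past, so [psi] can compute both [wo_k] and
    [wo_(k-1)] and add the difference of [wo_k] and [T' w_(k-1)]. *)

Lemma lne_neqy (R : realType) (x : R) : lne x%:E != +oo%E.
Proof. by rewrite /=; case: ifP. Qed.

(** A zero factor makes both sides [-oo], which absorbs under addition. *)
Lemma lne_mul_ge0 (R : realType) (a b : R) : 0 <= a -> 0 <= b ->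
  lne (a * b)%:E = (lne a%:E + lne b%:E)%E.
Proof.
rewrite le_eqVlt => /predU1P[<- _|a_gt0].
  by rewrite mul0r [lne 0%:E]le0_lneNy // addNye.
rewrite le_eqVlt => /predU1P[<-|b_gt0].
  by rewrite mulr0 [lne 0%:E]le0_lneNy // addeNy.
by rewrite EFinM lneM // in_itv /= lte_fin ?a_gt0 ?b_gt0 leey.
Qed.

Section UnnormalizedFilter.
Variables (R : realType) (n S : nat).
Variables (T : 'M[R]_n) (E : 'M[R]_(S, n)) (pi0 : 'cV[R]_n).

Fixpoint bayes_filter (y : nat -> 'cV[R]_S) (k : nat) : 'cV[R]_n :=
  if k is k'.+1 then
    \col_i ((E^T *m y k'.+1) i 0 * (T *m bayes_filter y k') i 0)
  else pi0.

Hypothesis (T_ge0 : forall i j, 0 <= T i j) (E_ge0 : forall i j, 0 <= E i j).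
Hypothesis pi0_ge0 : forall i, 0 <= pi0 i 0.

Section Observed.
Variable y : nat -> 'cV[R]_S.
Hypothesis y_onehot : forall k, (1 <= k)%N -> exists i, y k = delta_mx i 0.

Lemma likelihood_ge0 k i : (1 <= k)%N -> 0 <= (E^T *m y k) i 0.
Proof.
by move=> /y_onehot[j ->]; rewrite -colE !mxE.
Qed.

Lemma bayes_filter_ge0 k i : 0 <= bayes_filter y k i 0.
Proof.
elim: k i => [|k IHk] i //=; rewrite mxE mulr_ge0 ?likelihood_ge0 //.
by rewrite mxE sumr_ge0 // => j _; rewrite mulr_ge0.
Qed.

(** Nonnegativity of the filter lets [expeR] undo [lne] exactly, zero entries included, and lets
    [lne] turn the likelihood factor into a summand. *)
Lemma optimal_logitsE k : optimal_logits T E pi0 y k = logv (toev (bayes_filter y k)).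
Proof.
elim: k => [|k IHk] //=; rewrite IHk; apply/matrixP => i j.
rewrite !ord1 [in LHS]mxE [X in (X + _)%E]mxE [X in (_ + X)%E]mxE [RHS]mxE.
rewrite ![toev _ _ _]mxE [bayes_filter y k.+1 _ _]mxE.
set a := (E^T *m y k.+1) i 0; set b := (T *m bayes_filter y k) i 0.
have -> : mulmxv T (expv (logv (toev (bayes_filter y k)))) i 0 = b%:E.
  rewrite mxE /b mxE -sumEFin; apply: eq_bigr => h _.
  rewrite [expv _ _ _]mxE [logv _ _ _]mxE [toev _ _ _]mxE.
  suff /eqP-> : expeR (lne (bayes_filter y k h 0)%:E) == (bayes_filter y k h 0)%:E by [].
  by rewrite lneK_eq lee_fin bayes_filter_ge0.
have a_ge0 : 0 <= a by exact: likelihood_ge0.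
have b_ge0 : 0 <= b.
  by rewrite /b mxE sumr_ge0 // => h _; rewrite mulr_ge0 ?bayes_filter_ge0.
by rewrite addeC lne_mul_ge0.
Qed.

End Observed.

(** Allows [psi] to run the recursion on observations recovered from its window. *)
Lemma eq_optimal_logits (y y' : nat -> 'cV[R]_S) k :
    (forall j, (1 <= j <= k)%N -> y j = y' j) ->
  optimal_logits T E pi0 y k = optimal_logits T E pi0 y' k.
Proof.
elim: k => [|k IHk] //= eq_y; rewrite eq_y ?leqnn // IHk // => j /andP[j1 jk].
by rewrite eq_y // j1 leqW.
Qed.

End UnnormalizedFilter.

(** Since [0 * -oo = 0], infinite logits at the other indices contribute nothing. *)
Lemma mulmxv_row (R : realType) p n (A : 'M[R]_(p, n)) (v : 'cV[\bar R]_n) i j :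
  row i A = delta_mx 0 j -> mulmxv A v i 0 = v j 0.
Proof.
move=> /rowP rA; have A_ i' : A i i' = (i' == j)%:R.
  by have := rA i'; rewrite !mxE eqxx.
rewrite mxE (bigD1 j) //= A_ eqxx mul1e big1 ?adde0 // => h /negbTE hj.
by rewrite A_ hj mul0e.
Qed.

Section TransientDecay.
Variables (R : realType) (r m S : nat).
Variables (T11 : 'M[R]_r) (T21 : 'M[R]_(m, r)) (P : 'M[R]_m).
Variables (E : 'M[R]_(S, r + m)) (pi0 : 'cV[R]_(r + m)).
Variable y : nat -> 'cV[R]_S.
Let T := block_mx T11 0 T21 P.
Let beta := bayes_filter T E pi0 y.

Lemma bayes_filter_transientS k (i : 'I_r) :
  beta k.+1 (lshift m i) 0 =
  (E^T *m y k.+1) (lshift m i) 0 * (T11 *m usubmx (beta k)) i 0.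
Proof.
rewrite /beta /= [in LHS]mxE -/beta; congr (_ * _).
rewrite -[beta k]vsubmxK /T mul_block_col col_mxEu mul0mx addr0.
by rewrite !mxE; apply: eq_bigr => h _; rewrite col_mxKu.
Qed.

Hypotheses (T11_ge0 : forall i j, 0 <= T11 i j) (pi0_ge0 : forall i, 0 <= pi0 i 0).

Lemma pow_mul_ge0 k i : 0 <= (T11 ^+ k *m usubmx pi0) i 0.
Proof.
elim: k i => [|k IHk] i; first by rewrite expr0 mul1mx mxE.
by rewrite exprS -[_ * _]/(_ *m _) -mulmxA mxE sumr_ge0 // => j _; rewrite mulr_ge0.
Qed.

(* The likelihood factors only shrink the support of [T11 ^+ k *m pi0]. *)
Lemma bayes_filter_transient_eq0 k (i : 'I_r) :
  (T11 ^+ k *m usubmx pi0) i 0 = 0 -> beta k (lshift m i) 0 = 0.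
Proof.
elim: k i => [|k IHk] i; first by rewrite expr0 mul1mx mxE.
rewrite exprS -[_ * _]/(_ *m _) -mulmxA mxE => /eqP.
(* A zero sum of nonnegative terms is zero termwise: for each [j], either [T11 i j = 0] or the
   induction hypothesis applies at [j]. *)
rewrite psumr_eq0 => [/allP T11_0|j _]; last by rewrite mulr_ge0 ?pow_mul_ge0.
rewrite bayes_filter_transientS [X in _ * X]mxE big1 ?mulr0 // => j _.
have /= := T11_0 j (mem_index_enum j).
rewrite mulf_eq0 => /orP[/eqP->|/eqP/IHk bj0]; first by rewrite mul0r.
by rewrite mxE bj0 mulr0.
Qed.

Lemma bayes_filter_transient0 l k (i : 'I_r) :
  T11 ^+ l = 0 -> (l <= k)%N -> beta k (lshift m i) 0 = 0.
Proof.
move=> T11l /subnK <-; apply: bayes_filter_transient_eq0.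
by rewrite exprD T11l mulr0 mul0mx mxE.
Qed.

(** Once the transient entries are zero at time [k], [T21] feeds nothing in and the row of [P]
    selects a single entry. *)
Lemma bayes_filter_recurrentS l k (i j : 'I_m) :
    T11 ^+ l = 0 -> (l <= k)%N -> row i P = delta_mx 0 j ->
  beta k.+1 (rshift r i) 0 =
  (E^T *m y k.+1) (rshift r i) 0 * beta k (rshift r j) 0.
Proof.
move=> T11l lk rowP; rewrite /beta /= [in LHS]mxE -/beta; congr (_ * _).
have u0 : usubmx (beta k) = 0.
  by apply/colP => h; rewrite !mxE (bayes_filter_transient0 _ T11l).
have -> : T *m beta k = T *m col_mx 0 (dsubmx (beta k)).
  by rewrite -[in LHS](vsubmxK (beta k)) u0.
rewrite mul_block_col col_mxEd mulmx0 add0r.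
transitivity ((row i P *m dsubmx (beta k)) 0 0); last by rewrite rowP -rowE !mxE.
by rewrite -row_mul [RHS]mxE.
Qed.

End TransientDecay.

Section Psi.
Variables (R : realType) (n S l : nat).

(* The value [-oo] when [a] or [b] is infinite keeps the difference away from
   [+oo]. *)
Definition subr_or_Ny (a b : \bar R) : \bar R :=
  if (a \is a fin_num) && (b \is a fin_num) then (a - b)%E else -oo%E.

Lemma subr_or_Ny_neqy a b : subr_or_Ny a b != +oo%E.
Proof. by rewrite /subr_or_Ny; case: a b => [a| |] [b| |]. Qed.

(** Addition cannot raise [-oo], hence the implication between [b] and [a]; additive reachability
    supplies it later. *)
Lemma addr_subr_or_Ny a b : a != +oo%E -> (b = -oo%E -> a = -oo%E) ->
  b != +oo%E -> (b + subr_or_Ny a b)%E = a.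
Proof.
rewrite /subr_or_Ny; case: a b => [a| |] [b| |] //= _ h _; last by rewrite h.
by rewrite -EFinB -EFinD addrC subrK.
Qed.

(* A left inverse of [window] for times [k <= l]. *)
Definition unwindow (k : nat) (z : 'I_l -> 'cV[R]_S) (j : nat) : 'cV[R]_S :=
  if insub (k - j)%N is Some d then z d else 0.

Lemma unwindowK y k j : (1 <= j <= k)%N -> (k - j < l)%N ->
  unwindow k (window y k) j = y j.
Proof.
move=> /andP[j1 jk] kj; rewrite /unwindow insubT /= /window /=.
by rewrite ltn_subrL j1 (leq_trans j1 jk) subKn.
Qed.

End Psi.

Theorem theorem4p4 (R : realType) (r m S l : nat)
    (T : 'M[R]_(r + m)) (E : 'M[R]_(S, r + m)) (pi0 : 'cV[R]_(r + m))
    (T11 : 'M[R]_r) (T21 : 'M[R]_(m, r)) (P : 'M[R]_m)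
    (hpi0 : prob_vector pi0) (hE : col_stochastic E) (hT : deterministic T)
    (htransient : forall i : 'I_(r + m), transient T i = (i < r)%N)
    (hblock : T = block_mx T11 0 T21 P)
    (hT11 : strictly_lower_triangular T11) (hl : nilpotency_index T11 l)
    (hP : is_perm_mx P) (w0 : 'cV[R]_(r + m)) :
  let T' : 'M[R]_(r + m) := block_mx 1%:M 0 0 P in
  exists psi : nat -> ('I_l -> 'cV[R]_S) -> 'cV[\bar R]_(r + m),
    (forall k z i, psi k z i 0 != +oo%E) /\
    forall y : nat -> 'cV[R]_S,
      (forall k, (1 <= k)%N -> exists i, y k = delta_mx i 0) ->
      let wo := optimal_logits T E pi0 y in
      forall k, (1 <= k)%N ->
        (forall j, (1 <= j < k)%N ->
           additively_reachable T' (wo j) (wo j.+1)) ->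
        linear_logits T' psi w0 y k = wo k.
Proof.
move=> T'.
have [[l_gt0 T11l _] [pi0_ge0 _]] := (hl, hpi0).
have E_ge0 i j : 0 <= E i j by have [/(_ i)] := hE j; rewrite mxE.
have T_ge0 i j : 0 <= T i j.
  by have [h /colP/(_ i)] := hT j; rewrite !mxE andbT => ->.
have T11_ge0 i j : 0 <= T11 i j.
  by have := T_ge0 (lshift m i) (lshift m j); rewrite hblock block_mxEul.
have [s Ps] := is_perm_mxP P hP.
have row_P i : row i P = delta_mx 0 (s i) by apply/rowP => j; rewrite Ps !mxE eqxx eq_sym.
have T'l (v : 'cV[\bar R]_(r + m)) i :
    mulmxv T' v (lshift m i) 0 = v (lshift m i) 0.
  apply: mulmxv_row; apply/matrixP => a j; rewrite !ord1 mxE.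
  case: (split_ordP j) => h ->; rewrite ?block_mxEul ?block_mxEur !mxE.
    by rewrite eqxx eq_lshift eq_sym.
  by rewrite eq_rlshift.
have T'r (v : 'cV[\bar R]_(r + m)) i :
    mulmxv T' v (rshift r i) 0 = v (rshift r (s i)) 0.
  apply: mulmxv_row; apply/matrixP => a j; rewrite !ord1 mxE.
  case: (split_ordP j) => h ->; rewrite ?block_mxEdl ?block_mxEdr !mxE.
    by rewrite eq_lrshift.
  by have /rowP/(_ h) := row_P i; rewrite !mxE eqxx eq_rshift => ->.
have T'P (Q : \bar R -> Prop) (v : 'cV[\bar R]_(r + m)) :
    (forall i, Q (v i 0)) -> forall i, Q (mulmxv T' v i 0).
  by move=> Qv i; case: (split_ordP i) => h ->; rewrite ?T'l ?T'r.
(* Only the newest observation is read; it has index 0 in the window, a valid index because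
   [0 < l]. *)
pose late k (z : 'I_l -> 'cV[R]_S) (i : 'I_r + 'I_m) : \bar R :=
  if i is inr i' then lne (((E^T *m unwindow k z k) (rshift r i') 0)%:E)
  else -oo%E.
(* The vector to be cancelled at time [k]: at [k = 1] it is the arbitrary [w0], not [log pi0]. *)
pose prev k y := if (k <= 1)%N then toev w0 else optimal_logits T E pi0 y k.-1.
pose psi k (z : 'I_l -> 'cV[R]_S) : 'cV[\bar R]_(r + m) := \col_i
  if (k <= l)%N then
    subr_or_Ny (optimal_logits T E pi0 (unwindow k z) k i 0)
               (mulmxv T' (prev k (unwindow k z)) i 0)
  else late k z (fintype.split i).
exists psi; split=> [k z i|y y_onehot wo].
  rewrite mxE; case: ifP => _; first exact: subr_or_Ny_neqy.
  by rewrite /late; case: fintype.split => // i'; exact: lne_neqy.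
have woE k i : wo k i 0 = lne ((bayes_filter T E pi0 y k i 0)%:E).
  by rewrite /wo optimal_logitsE // !mxE.
have wo_neqy k i : wo k i 0 != +oo%E by rewrite woE lne_neqy.
elim=> // k IHk _ reach.
have lin_prev : linear_logits T' psi w0 y k = prev k.+1 y.
  case: k IHk reach => // k IHk reach; apply: IHk => // j /andP[j1 jk].
  by apply: reach; rewrite j1 ltnW.
apply/colP => i; rewrite [linear_logits _ _ _ _ _]/= lin_prev mxE [psi _ _ _ _]mxE.
case: leqP => kl; last first.
  (* Here [k.+1 <= l], so the window still contains all of [y 1], ..., [y k.+1]. *)
  have un j : (1 <= j <= k.+1)%N -> unwindow k.+1 (window y k.+1 : 'I_l -> _) j = y j.
    move=> jk; rewrite unwindowK //.
    by case/andP: jk => j1 _; apply: leq_trans kl; rewrite ltn_subrL j1.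
  rewrite (eq_optimal_logits _ _ _ un).
  have -> : prev k.+1 (unwindow k.+1 (window y k.+1 : 'I_l -> _)) = prev k.+1 y.
    rewrite /prev; case: ifP => // _; apply: eq_optimal_logits => j /andP[j1 jk].
    by rewrite un // j1 leqW.
  rewrite addr_subr_or_Ny //; last first.
    apply: (T'P (fun x => x != +oo%E)) => {}i.
    by rewrite /prev; case: ifP => // _; rewrite mxE.
  (* At the first step the entries of [w0] are finite, so nothing has to be reached from [-oo];
     afterwards the reachability assumption is used at [j = k]. *)
  rewrite /prev; case: ifP => [_|/negbT k1].
    by apply: (T'P (fun x => x = -oo%E -> _)) => h; rewrite mxE.
  by apply: reach; rewrite ltnS leqnn andbT; case: (k) k1.
(* Now [l <= k]: the transient entries vanish already at time [k], and [k >= 1] means that the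
   previous logits are [wo k] rather than [w0]. *)
have k_gt0 : (0 < k)%N by rewrite (leq_trans l_gt0).
have -> : prev k.+1 y = wo k by rewrite /prev ltnS leqNgt k_gt0.
case: (split_ordP i) => h ->; rewrite ?T'l ?T'r.
  rewrite /late addeNy woE hblock (bayes_filter_transient0 _ _ _ _ T11_ge0 pi0_ge0 _ T11l (leqW kl)).
  by rewrite le0_lneNy.
rewrite /late unwindowK ?leqnn // ?subnn // !woE addeC -lne_mul_ge0
  ?bayes_filter_ge0 ?likelihood_ge0 //.
by rewrite hblock (bayes_filter_recurrentS _ _ _ T11_ge0 pi0_ge0 T11l kl (row_P h)).
Qed.
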